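(* Let $\mathbb{K}$ be a ring with unit, $V,W$ right $\mathbb{K}$-modules, $U\subset V$ a non-empty subset and $f:U\to W$ a map. There is a 1:1-correspondence between (1) difference factorizers $f^{[1]}$ of $f$ satisfying $$f^{[1]}(x,v+v',t)=f^{[1]}(x+vt,v',t)+f^{[1]}(x,v,t)$$ for all $t\in\mathbb{K}$ (and all $x,v,v'$ with $x,\ x+vt,\ x+(v+v')t\in U$), and (2) morphisms of groupoids $f^{\{1\}}:U^{\{1\}}\to W^{\{1\}}$ over $f$, given by $f^{\{1\}}(x,v,t)=(f(x),f^{[1]}(x,v,t),t)$.
   Context: $\mathbb{K}$ is not assumed commutative. $U^{[1]}=U^{\{1\}}:=\{(x,v,t)\in V\times V\times\mathbb{K}\mid x\in U,\ x+vt\in U\}$ is the groupoid with object set $U\times\mathbb{K}$, source $\pi_0(x,v,t)=(x,t)$, target $\pi_1(x,v,t)=(x+vt,t)$, units $z(x,t)=(x,0,t)$, and composition $(x',v',t)\ast(x,v,t)=(x,v'+v,t)$ defined when $x'=x+vt$; likewise $W^{\{1\}}=W\times W\times\mathbb{K}$. A difference factorizer for $f$ is a map $f^{[1]}:U^{[1]}\to W$ with $f(x+vt)-f(x)=f^{[1]}(x,v,t)\cdot t$ for all $(x,v,t)\in U^{[1]}$. A morphism of groupoids $U^{\{1\}}\to W^{\{1\}}$ is over $f$ if its map on objects is $f\times\mathrm{id}_{\mathbb{K}}$. *)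

(* Defs.v *)
From HB Require Import structures.
From mathcomp Require Import all_boot all_algebra.
From mathcomp Require Import boolp classical_sets.

Set Implicit Arguments.
Unset Strict Implicit.
Unset Printing Implicit Defensive.

Import GRing.Theory.
Local Open Scope ring_scope.
Local Open Scope classical_set_scope.

(* A right K-module is a left module over the converse ring K^c. *)
Definition rscale (K : pzRingType) (V : lmodType K^c) (v : V) (t : K) : V :=
  (t : K^c) *: v.

Notation "v *:r t" := (rscale v t) (at level 40, left associativity).

Lemma rscaleDl (K : pzRingType) (V : lmodType K^c) (v w : V) (t : K) :
  (v + w) *:r t = v *:r t + w *:r t.
Proof. exact: scalerDr. Qed.

Lemma rscaleNl (K : pzRingType) (V : lmodType K^c) (v : V) (t : K) :
  (- v) *:r t = - (v *:r t).
Proof. exact: scalerN. Qed.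

Lemma rscale0l (K : pzRingType) (V : lmodType K^c) (t : K) :
  (0 : V) *:r t = 0.
Proof. exact: scaler0. Qed.

Lemma rscaleA (K : pzRingType) (V : lmodType K^c) (v : V) (s t : K) :
  v *:r (s * t) = (v *:r s) *:r t.
Proof. by rewrite /rscale scalerA. Qed.

(* Small groupoids, presented by sets of objects and arrows.  [gcomp g' g] is *)
(* "g' after g"; it takes the proof that the two arrows are composable.       *)
Record groupoid := Groupoid {
  gob : Type;
  garr : Type;
  gsrc : garr -> gob;
  gtgt : garr -> gob;
  gid : gob -> garr;
  gcomp : forall g' g : garr, gsrc g' = gtgt g -> garr;
  ginv : garr -> garr;
  gsrc_id : forall x, gsrc (gid x) = x;
  gtgt_id : forall x, gtgt (gid x) = x;
  gsrc_comp : forall g' g (h : gsrc g' = gtgt g), gsrc (gcomp h) = gsrc g;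
  gtgt_comp : forall g' g (h : gsrc g' = gtgt g), gtgt (gcomp h) = gtgt g';
  gcompA : forall g'' g' g (h : gsrc g' = gtgt g) (h' : gsrc g'' = gtgt g')
      (k : gsrc g'' = gtgt (gcomp h)) (k' : gsrc (gcomp h') = gtgt g),
    gcomp k = gcomp k';
  gcomp_idl : forall g (h : gsrc (gid (gtgt g)) = gtgt g), gcomp h = g;
  gcomp_idr : forall g (h : gsrc g = gtgt (gid (gsrc g))), gcomp h = g;
  gsrc_inv : forall g, gsrc (ginv g) = gtgt g;
  gtgt_inv : forall g, gtgt (ginv g) = gsrc g;
  gcompVg : forall g (h : gsrc (ginv g) = gtgt g), gcomp h = gid (gsrc g);
  gcompgV : forall g (h : gsrc g = gtgt (ginv g)), gcomp h = gid (gtgt g)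
}.

Record groupoid_morphism (G H : groupoid) := GroupoidMorphism {
  mob : gob G -> gob H;
  marr : garr G -> garr H;
  msrc : forall g, gsrc (marr g) = mob (gsrc g);
  mtgt : forall g, gtgt (marr g) = mob (gtgt g);
  mid : forall x, marr (gid x) = gid (mob x);
  mcomp : forall g' g (h : gsrc g' = gtgt g)
      (k : gsrc (marr g') = gtgt (marr g)),
    marr (gcomp h) = gcomp k
}.

Section SlopeGroupoid.
Variables (K : pzRingType) (V : lmodType K^c) (U : set V).

Definition slope_set : set (V * V * K) :=
  [set a | U a.1.1 /\ U (a.1.1 + a.1.2 *:r a.2)].

Definition slope (x v : V) (t : K) (hx : U x) (hxv : U (x + v *:r t)) :
    slope_set :=
  SigSub (mem_set (conj hx hxv : slope_set (x, v, t))).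

Definition direction (a : slope_set) : V := (val a).1.2.

Definition scale (a : slope_set) : K := (val a).2.

Definition base (a : slope_set) : U :=
  SigSub (mem_set (proj1 (set_mem (valP a)))).

Definition endpoint (a : slope_set) : U :=
  SigSub (mem_set (proj2 (set_mem (valP a)))).

Lemma slope_eq (a b : slope_set) :
    val (base a) = val (base b) -> direction a = direction b ->
  scale a = scale b -> a = b.
Proof.
case: a b => [[[x v] t] ha] [[[y w] s] hb]; rewrite /direction /scale /=.
by move=> exy evw ets; apply: val_inj; rewrite /= exy evw ets.
Qed.

Lemma slope_idP (x : U) (t : K) : U (val x + 0 *:r t).
Proof. by rewrite rscale0l addr0; exact: set_mem (valP x). Qed.

Lemma slope_shiftP (x v v' : V) (t : K) :
  U (x + (v + v') *:r t) -> U (x + v *:r t + v' *:r t).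
Proof. by rewrite rscaleDl addrA. Qed.

Definition slope_src (a : slope_set) : U * K := (base a, scale a).

Definition slope_tgt (a : slope_set) : U * K := (endpoint a, scale a).

Definition slope_id (p : U * K) : slope_set :=
  slope (set_mem (valP p.1)) (slope_idP p.1 p.2).

Lemma slope_compP (b a : slope_set) : slope_src b = slope_tgt a ->
  U (val (base a) + (direction b + direction a) *:r scale a).
Proof.
case=> eb es; case: (set_mem (valP b)) => _ /=.
rewrite [(val b).1.1]eb -/(direction b) -/(scale b) es /=.
by rewrite rscaleDl [direction b *:r _ + _]addrC addrA.
Qed.

Definition slope_comp (b a : slope_set) (h : slope_src b = slope_tgt a) :
    slope_set :=
  slope (set_mem (valP (base a))) (slope_compP h).

Lemma slope_invP (a : slope_set) :
  U (val (endpoint a) + (- direction a) *:r scale a).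
Proof.
case: a => [[[x v] t] ha]; rewrite /direction /scale /= rscaleNl addrK.
by case: (set_mem ha).
Qed.

Definition slope_inv (a : slope_set) : slope_set :=
  slope (set_mem (valP (endpoint a))) (slope_invP a).

Definition slope_groupoid : groupoid.
Proof.
apply: (@Groupoid (U * K) slope_set slope_src slope_tgt slope_id slope_comp
          slope_inv).
- by move=> [x t]; congr (_, _); exact: val_inj.
- move=> [x t]; congr (_, _); apply: val_inj.
  by rewrite /= rscale0l addr0.
- by move=> b a h; congr (_, _); exact: val_inj.
- move=> b a h; case: (h) => eb es; congr (_, _); last exact/esym.
  apply: val_inj => /=; rewrite [(val b).1.1]eb -/(scale b) es.
  by rewrite rscaleDl [direction b *:r _ + _]addrC addrA.
- move=> c b a h h' k k'; apply: slope_eq => //.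
  by rewrite /direction /= addrA.
- by move=> a h; apply: slope_eq => //; rewrite /direction /= add0r.
- by move=> a h; apply: slope_eq => //; rewrite /direction /= addr0.
- by move=> a; congr (_, _); exact: val_inj.
- move=> a; congr (_, _); apply: val_inj.
  by rewrite /= rscaleNl addrK.
- by move=> a h; apply: slope_eq => //; rewrite /direction /= addNr.
- move=> a h; apply: slope_eq => //; last by rewrite /direction /= addrN.
Defined.

End SlopeGroupoid.

Section FullGroupoid.
Variables (K : pzRingType) (W : lmodType K^c).

Definition full_src (a : W * W * K) : W * K := (a.1.1, a.2).

Definition full_tgt (a : W * W * K) : W * K := (a.1.1 + a.1.2 *:r a.2, a.2).

Definition full_id (p : W * K) : W * W * K := (p.1, 0, p.2).

Definition full_comp (b a : W * W * K) (_ : full_src b = full_tgt a) :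
    W * W * K :=
  (a.1.1, b.1.2 + a.1.2, a.2).

Definition full_inv (a : W * W * K) : W * W * K :=
  (a.1.1 + a.1.2 *:r a.2, - a.1.2, a.2).

(* The slope groupoid of the whole module, on W * W * K itself rather than on *)
(* a subtype of it.                                                           *)
Definition full_groupoid : groupoid.
Proof.
apply: (@Groupoid (W * K) (W * W * K) full_src full_tgt full_id full_comp
          full_inv); rewrite /full_src /full_tgt /full_id /full_comp /full_inv.
- by case.
- by case=> x t /=; rewrite rscale0l addr0.
- by [].
- move=> [[y w] s] [[x v] t] /= [-> ->].
  by rewrite rscaleDl [w *:r t + _]addrC addrA.
- by move=> c b a h h' k k' /=; rewrite addrA.
- by move=> [[x v] t] _ /=; rewrite add0r.
- by move=> [[x v] t] _ /=; rewrite addr0.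
- by [].
- by move=> [[x v] t] /=; rewrite rscaleNl addrK.
- by move=> [[x v] t] _ /=; rewrite addNr.
- by move=> [[x v] t] _ /=; rewrite addrN.
Defined.

End FullGroupoid.

Section Factorizers.
Variables (K : pzRingType) (V W : lmodType K^c) (U : set V) (f : U -> W).

Definition difference_factorizer (f1 : slope_set (K := K) U -> W) : Prop :=
  forall a, f (endpoint a) - f (base a) = f1 a *:r scale a.

Definition additive_slope (f1 : slope_set (K := K) U -> W) : Prop :=
  forall (x v v' : V) (t : K) (hx : U x) (hxv : U (x + v *:r t))
    (hxvv' : U (x + (v + v') *:r t)),
  f1 (slope hx hxvv') = f1 (slope hxv (slope_shiftP hxvv')) + f1 (slope hx hxv).

Definition morphism_over
    (F : groupoid_morphism (slope_groupoid U) (full_groupoid W)) : Prop :=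
  forall p : U * K, mob F p = (f p.1, p.2).

End Factorizers.

(* Main.v *)
Require Import Defs.
From HB Require Import structures.
From mathcomp Require Import all_boot all_algebra.
From mathcomp Require Import boolp classical_sets.

Set Implicit Arguments.
Unset Strict Implicit.
Unset Printing Implicit Defensive.

Import GRing.Theory.
Local Open Scope ring_scope.
Local Open Scope classical_set_scope.

(** For a morphism over [f], compatibility with sources forces the image of [(x, v, t)] to have
    first entry [f x] and last entry [t], so only the middle entry is free ([marr_over]). For that
    entry, compatibility with targets is exactly the factorizer identity, and compatibility with
    composition is exactly additivity. Compatibility with units then follows from additivity
    ([additive_slope_id]). Passing to the middle entry is therefore inverse to building the
    morphism. *)

(** The two maps are the only data of a morphism; the other fields are proofs, identified by proof
    irrelevance. *)
Lemma groupoid_morphism_ext (G H : groupoid) (E F : groupoid_morphism G H) :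
  mob E =1 mob F -> marr E =1 marr F -> E = F.
Proof.
case: E F => [oE aE sE tE iE cE] [oF aF sF tF iF cF] /= /funext eo /funext ea.
by subst oF aF; congr GroupoidMorphism; exact: Prop_irrelevance.
Qed.

Section Correspondence.
Variables (K : pzRingType) (V W : lmodType K^c) (U : set V) (f : U -> W).

(** Passes from coordinates to arrows: take [v] to be the direction of [a] and [v'] that of [b].
    Composition adds directions in the opposite order, hence the uses of commutativity. *)
Lemma additive_slope_comp (f1 : slope_set (K := K) U -> W) :
    additive_slope f1 ->
  forall (b a : slope_set U) (h : slope_src b = slope_tgt a),
  f1 (slope_comp h) = f1 b + f1 a.
Proof.
move=> f1D b a h; case: (h) => eb es.
have hx : U (val (base a)) := set_mem (valP (base a)).
have hxv : U (val (base a) + direction a *:r scale a) :=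
  set_mem (valP (endpoint a)).
have hxvv' : U (val (base a) + (direction a + direction b) *:r scale a).
  by rewrite [direction a + _]addrC; exact: slope_compP h.
have -> : slope_comp h = slope hx hxvv'.
  by apply: slope_eq => //; rewrite /direction /= addrC.
by rewrite f1D; congr (f1 _ + f1 _); apply: slope_eq.
Qed.

(* Units are idempotent, so additivity forces them to be sent to 0. *)
Lemma additive_slope_id (f1 : slope_set (K := K) U -> W) :
  additive_slope f1 -> forall p, f1 (slope_id p) = 0.
Proof.
move=> f1D p.
have h : slope_src (slope_id p) = slope_tgt (slope_id p).
  by congr (_, _); apply: val_inj; rewrite /= rscale0l addr0.
apply: (addrI (f1 (slope_id p))).
rewrite -(additive_slope_comp f1D h) addr0; congr f1.
by apply: slope_eq => //; rewrite /direction /= addr0.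
Qed.

(** Left transparent so that its object and arrow maps compute: being over [f] and the formula for
    arrows then hold by conversion. *)
Definition morphism_of_factorizer (f1 : slope_set (K := K) U -> W)
    (f1P : difference_factorizer f f1) (f1D : additive_slope f1) :
  groupoid_morphism (slope_groupoid U) (full_groupoid W).
Proof.
apply: (@GroupoidMorphism (slope_groupoid U) (full_groupoid W)
  (fun p => (f p.1, p.2)) (fun a => (f (base a), f1 a, scale a))).
- by [].
- by move=> a; rewrite /= /full_tgt /= -f1P addrC subrK.
- move=> p; rewrite /= /full_id additive_slope_id //=.
  by congr (f _, _, _); exact: val_inj.
- move=> b a h k; rewrite /= /full_comp /= additive_slope_comp //.
  by congr (f _, _, _); exact: val_inj.
Defined.

Definition factorizer_of_morphism
    (F : groupoid_morphism (slope_groupoid U) (full_groupoid W))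
    (a : slope_set (K := K) U) : W := (marr F a).1.2.

Section MorphismOver.
Variable F : groupoid_morphism (slope_groupoid U) (full_groupoid W).
Hypothesis Ff : morphism_over f F.

Lemma marr_over (a : slope_set U) :
  marr F a = (f (base a), factorizer_of_morphism F a, scale a).
Proof.
have := msrc F a; rewrite Ff /factorizer_of_morphism.
by case: (marr F a) => [[y w] s] [/= -> ->].
Qed.

(** This is [mtgt] read in the module component of the target. *)
Lemma factorizer_of_morphismP :
  difference_factorizer f (factorizer_of_morphism F).
Proof.
move=> a; have := mtgt F a; rewrite Ff marr_over => -[/= <-].
by rewrite addrC addKr.
Qed.

Lemma factorizer_of_morphismD : additive_slope (factorizer_of_morphism F).
Proof.
move=> x v v' t hx hxv hxvv'.
set a := slope hx hxv; set b := slope hxv _.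
have h : slope_src b = slope_tgt a by congr (_, _); exact: val_inj.
(* The images are composable too; the middle entry of their composite in [full_groupoid W] is by
   definition the sum. *)
have k : gsrc (marr F b) = gtgt (marr F a) by rewrite msrc mtgt; congr mob.
have -> : slope hx hxvv' = slope_comp h.
  by apply: slope_eq => //; rewrite /direction /= addrC.
by rewrite {1}/factorizer_of_morphism (@mcomp _ _ F b a h k).
Qed.

End MorphismOver.

End Correspondence.

Theorem theorem2p8 (K : pzRingType) (V W : lmodType K^c) (U : set V)
    (U_nonempty : U !=set0) (f : U -> W) :
  exists Phi :
      {f1 : slope_set U -> W | difference_factorizer f f1 /\ additive_slope f1}
      -> {F : groupoid_morphism (slope_groupoid U) (full_groupoid W)
         | morphism_over f F},
    bijective Phi /\
    (forall f1 (a : slope_set U),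
       marr (sval (Phi f1)) a = (f (base a), sval f1 a, scale a)).
Proof.
pose Phi (f1 : {f1 : slope_set U -> W |
    difference_factorizer f f1 /\ additive_slope f1}) :
    {F : groupoid_morphism (slope_groupoid U) (full_groupoid W)
       | morphism_over f F} :=
  exist (morphism_over f)
    (morphism_of_factorizer (proj1 (svalP f1)) (proj2 (svalP f1)))
    (fun=> erefl).
pose Psi (F : {F : groupoid_morphism (slope_groupoid U) (full_groupoid W)
       | morphism_over f F}) :
    {f1 : slope_set U -> W | difference_factorizer f f1 /\ additive_slope f1} :=
  exist (fun f1 => difference_factorizer f f1 /\ additive_slope f1)
    (factorizer_of_morphism (sval F))
    (conj (factorizer_of_morphismP (svalP F))
       (factorizer_of_morphismD (sval F))).
(* [Psi] after [Phi] returns [f1] by computation, so only [Phi] after [Psi] is left. *)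
exists Phi; split=> [|//]; exists Psi => [[f1 f1P]|[F Ff]]; apply: eq_exist => //=.
apply: groupoid_morphism_ext => [p|a] /=.
  by rewrite Ff.
by rewrite (marr_over Ff).
Qed.
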